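(* For every integer $d\ge 2$, one has $$\delta^\star(d)\ \ge\ \gamma(d).$$ Further, $$\lim_{d\to\infty}\frac{\gamma(d)}{\ln(d)} = 2\beta(1-\beta)\ \ge\ 0.40726,$$ where $\beta$ is the unique root of $2\beta\ln\beta-\beta+1$ in the open interval $(0,1)$.
   Context: For $x\in\mathbb{R}^d$ let $\sigma_{\max}(x)=\max_{i=1,\dots,d}x_i$. For $f,\sigma\colon\mathbb{R}^d\to\mathbb{R}$ write $\|f-\sigma\|_\infty=\sup_{x\in\mathbb{R}^d}|f(x)-\sigma(x)|\in[0,\infty]$. A function $f\colon\mathbb{R}^d\to\mathbb{R}$ is $1$-smooth in $\|\cdot\|_\infty$ if it is differentiable and $\|\nabla f(x)-\nabla f(y)\|_1\le\|x-y\|_\infty$ for all $x,y\in\mathbb{R}^d$. Define $$\delta^\star(d)=\inf\{\|f-\sigma_{\max}\|_\infty : f\colon\mathbb{R}^d\to\mathbb{R}\text{ is convex and }1\text{-smooth in }\|\cdot\|_\infty\}.$$ For an integer $d\ge2$ define $$\gamma(d)=\max\ \sum_{\ell=1}^{k}\left(1-\frac{j_{\ell-1}}{j_\ell}\right)^2,$$ where the maximum is over all integers $k\ge 1$ and all integer sequences $1=j_0<j_1<\dots<j_{k-1}<j_k=d$. *)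

(* Defs.v *)
From mathcomp Require Import all_boot all_order all_algebra.
From mathcomp Require Import all_classical all_reals all_analysis.

Set Implicit Arguments.
Unset Strict Implicit.
Unset Printing Implicit Defensive.

Import Order.TTheory GRing.Theory Num.Theory.
Import numFieldNormedType.Exports.

Local Open Scope classical_set_scope.
Local Open Scope ring_scope.

(* A vector of R^d is an x : 'rV[R]_d, and the library norm `|x| on 'rV[R]_d
   is max_i |x_i|. *)

(* A maximum as soon as 0 < d: see sigma_maxP. *)
Definition sigma_max (R : realType) (d : nat) (x : 'rV[R]_d) : R :=
  sup (range (fun i : 'I_d => x ord0 i)).

Definition sup_dist (R : realType) (d : nat) (f g : 'rV[R]_d -> R) : \bar R :=
  ereal_sup (range (fun x : 'rV[R]_d => `|f x - g x|%:E)).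

Definition l1norm (R : realType) (d : nat) (x : 'rV[R]_d) : R :=
  \sum_(i < d) `|x ord0 i|.

Definition gradient (R : realType) (d : nat) (f : 'rV[R]_d -> R)
    (x : 'rV[R]_d) : 'rV[R]_d :=
  \row_(i < d) 'D_(delta_mx ord0 i) f x.

Definition one_smooth (R : realType) (d : nat) (f : 'rV[R]_d -> R) : Prop :=
  (forall x : 'rV[R]_d, differentiable f x) /\
  (forall x y : 'rV[R]_d, l1norm (gradient f x - gradient f y) <= `|x - y|).

Definition delta_star (R : realType) (d : nat) : \bar R :=
  ereal_inf [set sup_dist f (@sigma_max R d) | f in
    [set f : 'rV[R]_d -> R | convex_function setT f /\ one_smooth f]].

(* Only the values j 0, ..., j k matter. *)
Definition is_chain (d k : nat) (j : nat -> nat) : Prop :=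
  [/\ (1 <= k)%N, j 0%N = 1%N, j k = d &
      forall l : nat, (l < k)%N -> (j l < j l.+1)%N].

Definition chain_sum (R : realType) (k : nat) (j : nat -> nat) : R :=
  \sum_(1 <= l < k.+1) (1 - (j l.-1)%:R / (j l)%:R) ^+ 2.

Arguments chain_sum : clear implicits.

Definition chain_sums (R : realType) (d : nat) : set R :=
  [set v | exists k j, is_chain d k j /\ v = chain_sum R k j].

Arguments chain_sums : clear implicits.

(* A maximum as soon as 1 < d: see gammaP. *)
Definition gamma (R : realType) (d : nat) : R := sup (chain_sums R d).

Arguments gamma : clear implicits.
Arguments delta_star : clear implicits.

Lemma sup_finite_max (R : realType) (A : set R) :
  finite_set A -> A !=set0 -> A (sup A) /\ ubound A (sup A).
Proof.
case/finite_seqP => s -> [a0 /= a0s].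
pose m := \big[Order.max/a0]_(x <- s) x.
have ms : m \in s.
  rewrite /m big_seq; elim/big_ind : _ => // x y xs ys.
  by rewrite maxEle; case: ifP.
have mub : ubound [set` s] m.
  by move=> x /= xs; apply: (le_bigmax_seq a0 x).
have sE : sup [set` s] = m.
  apply/le_anti/andP; split; first by apply: ge_sup => //; exists a0.
  by apply: ub_le_sup; first by exists m.
by rewrite sE.
Qed.

Lemma sigma_maxP (R : realType) (d : nat) (x : 'rV[R]_d) : (0 < d)%N ->
  range (fun i : 'I_d => x ord0 i) (sigma_max x) /\
  forall i : 'I_d, x ord0 i <= sigma_max x.
Proof.
move=> d0; have [||h1 h2] := @sup_finite_max R (range (fun i : 'I_d => x ord0 i)).
- by apply: finite_image; exact: finite_finset.
- by exists (x ord0 (Ordinal d0)), (Ordinal d0).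
- by split=> // i; apply: h2; exists i.
Qed.

Lemma is_chain_le (d k : nat) (j : nat -> nat) (l m : nat) : is_chain d k j ->
  (l <= m <= k)%N -> (j l + (m - l) <= j m)%N.
Proof.
case=> _ _ _ jS /andP[]; elim: m => [|m IH].
  by rewrite leqn0 => /eqP-> _; rewrite addn0.
rewrite leq_eqVlt => /predU1P[-> _|lm mk]; first by rewrite subnn addn0.
by rewrite subSn// addnS; exact: leq_ltn_trans (IH lm (ltnW mk)) (jS _ mk).
Qed.

Lemma gammaP (R : realType) (d : nat) : (1 < d)%N ->
  chain_sums R d (gamma R d) /\ ubound (chain_sums R d) (gamma R d).
Proof.
move=> d1; apply: sup_finite_max.
  pose F (p : 'I_d.+1 * {ffun 'I_d.+1 -> 'I_d.+1}) : R :=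
    chain_sum R p.1 (fun l => p.2 (inord l)).
  apply: (@sub_finite_set _ _ (range F)); last first.
    by apply: finite_image; exact: finite_finset.
  move=> _ [k [j [jc ->]]]; have [_ j0 jk _] := jc.
  have jd l : (l <= k)%N -> (j l <= d)%N.
    move=> lk; rewrite -jk; apply: leq_trans (is_chain_le (m := k) jc _).
      exact: leq_addr.
    by rewrite lk leqnn.
  have kd : (k < d.+1)%N.
    rewrite ltnS -jk; apply: leq_trans (is_chain_le (l := 0%N) (m := k) jc _).
      by rewrite subn0 leq_addl.
    by rewrite leqnn.
  exists (Ordinal kd, [ffun i : 'I_d.+1 => inord (j i)]) => //=.
  rewrite /F /chain_sum /= [LHS]big_nat_cond [RHS]big_nat_cond.
  have jE l : (l <= k)%N ->
      [ffun i : 'I_d.+1 => inord (j i) : 'I_d.+1] (inord l) = j l :> nat.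
    move=> lk; have ld : (l < d.+1)%N := leq_ltn_trans lk kd.
    have jl : (j l < d.+1)%N by rewrite ltnS jd.
    by rewrite ffunE (inordK ld) (inordK jl).
  apply: eq_bigr => l /andP[/andP[l0 lk] _].
  by rewrite !jE// (leq_trans (leq_pred _)).
pose j l := if l is 0%N then 1%N else d.
exists (chain_sum R 1 j), 1%N, j; split=> //; split=> // l.
by rewrite ltnS leqn0 => /eqP ->.
Qed.

(* Main.v *)
Require Import Defs.
From mathcomp Require Import all_boot all_order all_algebra.
From mathcomp Require Import all_classical all_reals all_analysis.
From mathcomp Require Import ring lra.

Set Implicit Arguments.
Unset Strict Implicit.
Unset Printing Implicit Defensive.

Import Order.TTheory GRing.Theory Num.Theory.
Import numFieldNormedType.Exports.

Local Open Scope classical_set_scope.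
Local Open Scope ring_scope.

(** The lower bound on [delta_star] is a statement about the convex conjugate
    [h p = sup_x <x, p> - f x].  If [f] stays within [delta] of [sigma_max],
    then [h <= delta] on the whole simplex, and [h p >= - f 0 >= - delta] for
    every [p].  Smoothness of [f] in the sup norm makes [h] strongly convex in
    the l1 norm: a point [x] that nearly attains the supremum for [p] has a
    gradient close to [p], and moving from [x] along sign vectors shows that [h]
    exceeds its linearization at [p] by at least half the squared l1 distance to
    [p], up to the error made in the choice of [x].  Take for [p] the
    uniform measure on [j] coordinates.  It is the average of the uniform
    measures on the [j] cyclic windows of length [i] among these coordinates,
    and each of them lies at l1 distance [2 * (1 - i / j)] from [p]; averaging
    cancels the linear terms, hence the largest value [H i] of [h] at a uniform
    measure on [i] coordinates satisfies
    [H i >= H j + 2 * (1 - i / j) ^+ 2] ([sup_dual_values_step]).  Along a chain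
    from [1] to [d] these gains add up to at most
    [H 1 - H d <= 2 * delta] ([gamma_le_dist]).

    For the growth of [gamma], put [C = 2 * b * (1 - b)].  The equation defining
    [b] says that [r = b] is a critical point of [(1 - r) ^+ 2 / (- ln r)], with
    critical value [C], and this is the maximum over [0 < r < 1]
    ([sqr_le_ln]).  Applied to the ratios of consecutive terms of a chain it
    telescopes to [gamma d <= C * ln d] ([gamma_le_ln]).  Conversely, the chain
    of integer parts of the powers of [b^-1] has ratios so close to [b] that the
    total loss is bounded ([ln_le_gamma]), which gives the limit.  Since
    [C] is a maximum, the quotient at [r = 2 / 7], a rational close to [b], bounds
    it from below and gives the numerical bound.
*)

(** * Smooth functions in the sup norm *)

Lemma mx_entry_le_norm (R : realType) (d : nat) (z : 'rV[R]_d) (i : 'I_d) :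
  `|z ord0 i| <= `|z|.
Proof.
rewrite [leRHS]mx_normrE.
exact: (le_bigmax _ (fun ij : 'I_1 * 'I_d => `|z ij.1 ij.2|) (ord0, i)).
Qed.

Lemma mx_norm_le1 (R : realType) (d : nat) (z : 'rV[R]_d) :
  (forall i, `|z ord0 i| <= 1) -> `|z| <= 1.
Proof.
move=> h; rewrite [leLHS]mx_normrE.
by apply/bigmax_leP; split=> // -[i j] _ /=; rewrite (ord1 i).
Qed.

Lemma derive_gradient (R : realType) (d : nat) (f : 'rV[R]_d -> R)
    (x z : 'rV[R]_d) : differentiable f x ->
  'D_z f x = \sum_(i < d) z ord0 i * gradient f x ord0 i.
Proof.
move=> df; rewrite deriveE// {1}(row_sum_delta z) linear_sum/=.
by apply: eq_bigr => i _; rewrite linearZ/= mxE deriveE.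
Qed.

Lemma is_derive_line (R : realType) (d : nat) (f : 'rV[R]_d -> R)
    (x z : 'rV[R]_d) (t : R) : differentiable f (x + t *: z) ->
  is_derive t 1 (fun s : R => f (x + s *: z)) ('D_z f (x + t *: z)).
Proof.
move=> df.
have E : (fun h : R => h^-1 *:
              (((fun s : R => f (x + s *: z)) \o shift t) (h *: 1)
               - f (x + t *: z)))
       = (fun h : R => h^-1 *:
              ((f \o shift (x + t *: z)) (h *: z) - f (x + t *: z))).
  apply/funext => h /=; congr (_ *: (f _ - _)).
  by rewrite [h *: 1]mulr1 scalerDl addrCA.
split; first by rewrite /derivable E; exact: diff_derivable.
by rewrite /derive E.
Qed.

(** Subtract from [f] along the segment its tangent and the parabola
    [t ^+ 2 * `|z| ^+ 2 / 2]: by the duality of the l1 and sup norms, the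
    Lipschitz bound on the gradient makes the derivative of the difference
    nonpositive. *)
Lemma one_smooth_descent (R : realType) (d : nat) (f : 'rV[R]_d -> R)
    (x z : 'rV[R]_d) : one_smooth f ->
  f (x + z) <= f x + 'D_z f x + `|z| ^+ 2 / 2.
Proof.
move=> [df gf].
pose F (t : R) : R := f (x + t *: z) - t * 'D_z f x - t ^+ 2 * (`|z| ^+ 2 / 2).
pose dF (t : R) : R := 'D_z f (x + t *: z) - 'D_z f x - t * `|z| ^+ 2.
have FE (t : R) : is_derive t 1 F (dF t).
  have := @is_derive_line R d f x z t (df _) => h; rewrite /F.
  by apply: is_derive_eq; rewrite /GRing.scale/= /dF; field.
have [|c cab] := @MVT_segment R F dF 0 1 ler01 (fun t _ => FE t).
  by apply: derivable_within_continuous => t _; have := FE t.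
move: cab; rewrite in_itv/= => /andP[c0 c1].
rewrite /F scale0r scale1r addr0 subr0 mulr1 => E.
suff : dF c <= 0 by move: E => <-; lra.
rewrite /dF !derive_gradient// -sumrB subr_le0.
have := gf (x + c *: z) x; rewrite addrAC subrr add0r normrZ ger0_norm// => hg.
apply: (@le_trans _ _ (l1norm (gradient f (x + c *: z) - gradient f x) * `|z|)).
  rewrite /l1norm mulr_suml; apply: ler_sum => i _.
  rewrite -mulrBr (le_trans (ler_norm _))// normrM mulrC.
  by rewrite ler_pM// ?mx_entry_le_norm// !mxE.
by rewrite expr2 mulrA ler_wpM2r.
Qed.

(** * The conjugate at uniform measures *)

(** The pairing of [x] with the uniform measure on a set of [j] coordinates.
    The set is given by an injective listing [e], so that the group structure of
    ['I_j] provides its cyclic windows. *)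
Definition coord_mean (R : realType) (d j : nat) (e : 'I_j -> 'I_d)
    (x : 'rV[R]_d) : R :=
  j%:R^-1 * \sum_k x ord0 (e k).

(** The supremum of this over [x] is the convex conjugate of [f] at the uniform
    measure on the image of [e], when [e] is injective. *)
Definition dual_value (R : realType) (d : nat) (f : 'rV[R]_d -> R) (j : nat)
    (e : 'I_j -> 'I_d) (x : 'rV[R]_d) : R :=
  coord_mean e x - f x.

Definition dual_values (R : realType) (d : nat) (f : 'rV[R]_d -> R) (j : nat) :
    set R :=
  [set v | exists e : 'I_j -> 'I_d,
     injective e /\ exists x, v = dual_value f e x].

Lemma coord_meanDZ (R : realType) (d j : nat) (e : 'I_j -> 'I_d)
    (x z : 'rV[R]_d) (t : R) :
  coord_mean e (x + t *: z) = coord_mean e x + t * coord_mean e z.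
Proof.
rewrite /coord_mean (eq_bigr (fun r => x ord0 (e r) + t * z ord0 (e r))).
  by rewrite big_split/= -mulr_sumr; ring.
by move=> r _; rewrite !mxE.
Qed.

Lemma dual_value_le (R : realType) (d : nat) (f : 'rV[R]_d -> R) (delta : R)
    (j : nat) (e : 'I_j -> 'I_d) (x : 'rV[R]_d) :
  (forall x, `|f x - sigma_max x| <= delta) -> (0 < j)%N ->
  dual_value f e x <= delta.
Proof.
move=> fd j0.
have d0 : (0 < d)%N by exact: leq_ltn_trans (ltn_ord (e (Ordinal j0))).
have [_ sx] := sigma_maxP x d0.
have : coord_mean e x <= sigma_max x.
  rewrite /coord_mean ler_pdivrMl ?ltr0n//.
  apply: le_trans (_ : \sum_(k < j) sigma_max x <= _); first exact: ler_sum.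
  by rewrite sumr_const card_ord mulr_natl.
have := fd x; rewrite ler_norml => /andP[]; rewrite /dual_value; lra.
Qed.

Lemma has_sup_dual_values (R : realType) (d : nat) (f : 'rV[R]_d -> R)
    (delta : R) (j : nat) :
  (forall x, `|f x - sigma_max x| <= delta) -> (0 < j <= d)%N ->
  has_sup (dual_values f j).
Proof.
move=> fd /andP[j0 jd]; split.
  exists (dual_value f (widen_ord jd) 0), (widen_ord jd).
  split; last by exists 0.
  by move=> a b /(congr1 val)/= ab; apply: val_inj.
by exists delta => _ [e [_ [x ->]]]; exact: dual_value_le.
Qed.

Lemma dual_value_shift (R : realType) (d : nat) (f : 'rV[R]_d -> R) (j : nat)
    (e : 'I_j -> 'I_d) (x s : 'rV[R]_d) (t : R) :
  one_smooth f -> `|s| <= 1 ->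
  dual_value f e x + t * (coord_mean e s - 'D_s f x) - t ^+ 2 / 2
    <= dual_value f e (x + t *: s).
Proof.
move=> sf s1; rewrite /dual_value coord_meanDZ.
have := one_smooth_descent x (t *: s) sf; case: sf => df _.
rewrite deriveE// linearZ/= -deriveE// => h.
have : `|t *: s| ^+ 2 <= t ^+ 2.
  rewrite normrZ exprMn real_normK ?num_real//.
  by rewrite ler_piMr ?sqr_ge0// expr_le1.
by move: h; rewrite /GRing.scale/=; lra.
Qed.

(** Moving from [x] along [s] by the discrepancy between the measure of [e] and
    the gradient, both tested against [s], raises the dual value by half the
    square of this discrepancy, and only [eta ^+ 2 / 2] is left below [M]. *)
Lemma dual_value_near_max (R : realType) (d : nat) (f : 'rV[R]_d -> R)
    (j : nat) (e : 'I_j -> 'I_d) (x s : 'rV[R]_d) (M eta : R) :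
  one_smooth f -> `|s| <= 1 -> 0 < eta ->
  (forall y, dual_value f e y <= M) -> M - eta ^+ 2 / 2 < dual_value f e x ->
  'D_s f x <= coord_mean e s + eta.
Proof.
move=> sf s1 eta0 Mub hx.
have := Mub (x + (coord_mean e s - 'D_s f x) *: s).
have := dual_value_shift e x (coord_mean e s - 'D_s f x) sf s1.
move: ('D_s f x) (coord_mean e s) => D m; nra.
Qed.

(** * Cyclic windows *)

Definition window (d i n : nat) (lein : (i <= n.+1)%N) (e : 'I_n.+1 -> 'I_d)
    (m : 'I_n.+1) (r : 'I_i) : 'I_d :=
  e (widen_ord lein r + m).

(** The vector dual to the difference between the uniform measure on the [m]-th
    window of length [i] and the uniform measure on the image of [e]. *)
Definition window_sign (R : realType) (d i n : nat) (e : 'I_n.+1 -> 'I_d)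
    (m : 'I_n.+1) : 'rV[R]_d :=
  \row_y if [exists k, (e k == y) && ((k - m)%R < i)%N] then 1 else - 1.

Lemma window_inj (d i n : nat) (lein : (i <= n.+1)%N) (e : 'I_n.+1 -> 'I_d)
    (m : 'I_n.+1) : injective e -> injective (window lein e m).
Proof.
by move=> ie r r' /ie/addIr/(congr1 val)/= rr; apply: val_inj.
Qed.

Lemma window_sign_norm (R : realType) (d i n : nat) (e : 'I_n.+1 -> 'I_d)
    (m : 'I_n.+1) : `|window_sign R i e m| <= 1.
Proof.
by apply: mx_norm_le1 => y; rewrite mxE; case: ifP; rewrite ?normrN normr1.
Qed.

Lemma window_signE (R : realType) (d i n : nat) (e : 'I_n.+1 -> 'I_d)
    (m k : 'I_n.+1) : injective e ->
  window_sign R i e m ord0 (e k) = if ((k - m)%R < i)%N then 1 else - 1.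
Proof.
move=> ie; rewrite mxE; congr (if _ then _ else _).
apply/existsP/idP => [[k']|h]; first by move=> /andP[/eqP/ie ->].
by exists k; rewrite eqxx.
Qed.

Lemma window_sum (R : realType) (n i : nat) (m : 'I_n.+1) : (i <= n.+1)%N ->
  \sum_(k < n.+1) (if ((k - m)%R < i)%N then 1 else - 1)
    = i%:R *+ 2 - n.+1%:R :> R.
Proof.
move=> ij; rewrite (reindex_inj (addIr m)).
transitivity (\sum_(k < n.+1) ((if (k < i)%N then 1 else 0) *+ 2 - 1) : R).
  by apply: eq_bigr => k _; rewrite addrK; case: ifP => _; ring.
rewrite sumrB sumr_const card_ord sumrMnl -big_mkcond/=.
by rewrite -(big_ord_widen _ (fun _ => 1)) // sumr_const card_ord.
Qed.

Lemma coord_mean_window_sign (R : realType) (d i n : nat)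
    (e : 'I_n.+1 -> 'I_d) (m : 'I_n.+1) : (i <= n.+1)%N -> injective e ->
  coord_mean e (window_sign R i e m) = 1 - 2 * (1 - i%:R / n.+1%:R).
Proof.
move=> lein ie; rewrite /coord_mean.
under eq_bigr do rewrite window_signE//.
rewrite window_sum// mulrBr mulVf// -[_ *+ 2]mulr_natl; field.
by rewrite ?gt_eqF// addr_gt0.
Qed.

Lemma coord_mean_window (R : realType) (d i n : nat) (lein : (i <= n.+1)%N)
    (e : 'I_n.+1 -> 'I_d) (m : 'I_n.+1) : (0 < i)%N -> injective e ->
  coord_mean (window lein e m) (window_sign R i e m) = 1.
Proof.
move=> i0 ie; rewrite /coord_mean (eq_bigr (fun=> 1)); last first.
  by move=> r _; rewrite window_signE// addrK /= ltn_ord.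
by rewrite sumr_const card_ord mulVf// pnatr_eq0 -lt0n.
Qed.

(** Every position of the cycle is covered by exactly [i] windows. *)
Lemma mean_coord_mean_window (R : realType) (d i n : nat) (lein : (i <= n.+1)%N)
    (e : 'I_n.+1 -> 'I_d) (x : 'rV[R]_d) : (0 < i)%N ->
  n.+1%:R^-1 * \sum_m coord_mean (window lein e m) x = coord_mean e x.
Proof.
move=> i0; congr (_ * _); rewrite -mulr_sumr exchange_big/=.
rewrite (eq_bigr (fun=> \sum_k x ord0 (e k))); last first.
  by move=> r _; rewrite [RHS](reindex_inj (addrI (widen_ord lein r))).
rewrite sumr_const card_ord -[(\sum_(k < n.+1) _) *+ i]mulr_natl.
by rewrite mulrA mulVf ?mul1r// pnatr_eq0 -lt0n.
Qed.

(** * The lower bound on the smoothing error *)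

(** Strong convexity of the conjugate, averaged over the windows: the linear
    terms cancel because the windows average to the whole, so some window
    gains almost [a ^+ 2 / 2], where [a] is its l1 distance to the whole. *)
Lemma sup_dual_values_step (R : realType) (d : nat) (f : 'rV[R]_d -> R)
    (delta : R) (i j : nat) :
  one_smooth f -> (forall x, `|f x - sigma_max x| <= delta) ->
  (0 < i)%N -> (i <= j)%N -> (j <= d)%N ->
  sup (dual_values f j) + 2 * (1 - i%:R / j%:R) ^+ 2
    <= sup (dual_values f i).
Proof.
case: j => [|n]; first by case: i.
move=> sf fd i0 ij jd; set j := n.+1.
have supi : has_sup (dual_values f i).
  by apply: has_sup_dual_values fd _; rewrite i0 (leq_trans ij).
have supj : has_sup (dual_values f j).
  by apply: has_sup_dual_values fd _; rewrite jd.
set Vi := sup (dual_values f i); set Vj := sup (dual_values f j).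
have j0 : 0 < j%:R :> R by rewrite ltr0n.
have q1 : i%:R / j%:R <= 1 :> R by rewrite ler_pdivrMr// mul1r ler_nat.
have q0 : 0 <= i%:R / j%:R :> R by rewrite divr_ge0.
set a : R := 2 * (1 - i%:R / j%:R).
have a0 : 0 <= a by rewrite /a mulr_ge0// subr_ge0.
(* The supremum need not be attained, so a maximizer is replaced by a point
   within [eta ^+ 2 / 2] of the supremum; as [a <= 2], the total loss is at most
   [3 * eta]. *)
suff H (eta : R) : 0 < eta -> Vj - eta ^+ 2 / 2 + a ^+ 2 / 2 - a * eta <= Vi.
  apply/ler_addgt0Pr => g g0.
  pose eta := Num.min 1 (g / 3).
  have e0 : 0 < eta by rewrite lt_min ltr01 divr_gt0.
  have e1 : eta <= 1 by rewrite ge_min lexx.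
  have eg : eta <= g / 3 by rewrite ge_min lexx orbT.
  have := H _ e0; rewrite -/Vi -/Vj /a; move: (i%:R / j%:R) q0 q1 => q q0 q1.
  nra.
move=> eta0.
have [_ [e [ie [x ->]]]] :=
  sup_adherent (divr_gt0 (exprn_gt0 2 eta0) (ltr0n R 2)) supj.
rewrite -/Vj => hx.
have key m : coord_mean (window ij e m) x <= Vi + f x - a ^+ 2 / 2 + a * eta.
  have s1 := @window_sign_norm R d i n e m.
  have : 'D_(window_sign R i e m) f x <= 1 - a + eta.
    rewrite -(coord_mean_window_sign R m ij ie).
    apply: (dual_value_near_max sf s1 eta0 _ hx) => y.
    by apply: sup_upper_bound => //; exists e; split=> //; exists y.
  have := dual_value_shift (window ij e m) x a sf s1.
  rewrite (coord_mean_window _ _ _ i0 ie).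
  have : dual_value f (window ij e m) (x + a *: window_sign R i e m) <= Vi.
    apply: sup_upper_bound => //; exists (window ij e m).
    by split; [exact: window_inj|eexists].
  rewrite {2}/dual_value; move: ('D_(window_sign R i e m) f x) => D; nra.
have : coord_mean e x <= Vi + f x - a ^+ 2 / 2 + a * eta.
  rewrite -(mean_coord_mean_window ij _ _ i0) ler_pdivrMl//.
  apply: le_trans (_ : \sum_(m < j) (Vi + f x - a ^+ 2 / 2 + a * eta) <= _).
    exact: ler_sum.
  by rewrite sumr_const card_ord mulr_natl.
move: hx; rewrite /dual_value; lra.
Qed.

(** The gains of [sup_dual_values_step] telescope along an optimal chain.  At
    its end [d] the conjugate is at least [- f 0], hence at least [- delta]; at
    its start [1] it is at most [delta]. *)
Lemma gamma_le_dist (R : realType) (d : nat) (f : 'rV[R]_d -> R) (delta : R) :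
  (1 < d)%N -> one_smooth f -> (forall x, `|f x - sigma_max x| <= delta) ->
  gamma R d <= delta.
Proof.
move=> d1 sf fd; have [[k [j [jc ->]]] _] := gammaP R d1.
have d0 := ltnW d1.
have [_ j0 jk jS] := jc.
have jpos m : (m <= k)%N -> (0 < j m <= d)%N.
  move=> mk; have := is_chain_le (l := 0%N) jc mk.
  have := is_chain_le (l := m) (m := k) jc.
  rewrite mk leqnn jk j0 => /(_ isT) h h'.
  by rewrite (leq_trans _ h')// (leq_trans _ h)// leq_addr.
have H m : (m <= k)%N ->
    2 * \sum_(1 <= l < m.+1) (1 - (j l.-1)%:R / (j l)%:R) ^+ 2
     + sup (dual_values f (j m)) <= sup (dual_values f 1).
  elim: m => [_|m IH mk]; first by rewrite big_geq// j0 mulr0 add0r.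
  have /andP[_ h2] := jpos _ mk.
  have /andP[h1 _] := jpos _ (ltnW mk).
  rewrite big_nat_recr//=; have := IH (ltnW mk).
  have := sup_dual_values_step sf fd h1 (ltnW (jS _ mk)) h2.
  lra.
have := H k (leqnn _); rewrite jk -/(chain_sum R k j).
have : sup (dual_values f 1) <= delta.
  have [ne _] : has_sup (dual_values f 1).
    by apply: has_sup_dual_values fd _; rewrite d0.
  by apply: ge_sup => // _ [e [_ [x ->]]]; exact: dual_value_le.
have : - delta <= sup (dual_values f d).
  apply: le_trans (_ : dual_value f id 0 <= _).
    rewrite /dual_value /coord_mean big1 ?mulr0 ?sub0r ?lerN2; last first.
      by move=> i _; rewrite mxE.
    have [[i _] /= s0 _] := sigma_maxP (0 : 'rV[R]_d) d0.
    have := fd 0; rewrite -s0 mxE subr0; exact/le_trans/ler_norm.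
  apply: sup_upper_bound.
    by apply: has_sup_dual_values fd _; rewrite d0 leqnn.
  by exists id; split=> //; exists 0.
lra.
Qed.

Lemma gamma_le_delta_star (R : realType) (d : nat) : (1 < d)%N ->
  ((gamma R d)%:E <= delta_star R d)%E.
Proof.
move=> d1; apply: le_ereal_inf_tmp => _ [f [_ sf] <-].
have ub x : (`|f x - sigma_max x|%:E <= sup_dist f (@sigma_max R d))%E.
  by apply: ereal_sup_ubound; exists x.
case: (sup_dist _ _) ub => [delta| |] ub.
- by rewrite lee_fin; apply: gamma_le_dist d1 sf _ => x; rewrite -lee_fin.
- exact: leey.
- by have := ub 0; rewrite leeNy_eq.
Qed.

(** * The critical ratio *)

Definition critical_ratio (R : realType) (b : R) : Prop :=
  0 < b < 1 /\ 2 * b * ln b - b + 1 = 0.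

Definition log_quad (R : realType) (A p q x : R) : R :=
  A * ln x + p * x + q * x ^+ 2.

Lemma is_derive_log_quad (R : realType) (A p q x : R) : 0 < x ->
  is_derive x 1 (log_quad A p q) (A / x + p + 2 * q * x).
Proof.
move=> x0; have dln := is_derive1_ln x0.
rewrite /log_quad; apply: is_derive_eq.
rewrite /GRing.scale/= /GRing.scale/=.
ring.
Qed.

Lemma log_quad_lt (R : realType) (A p q a b : R) : 0 < a -> a < b ->
  (forall x, a < x < b -> 0 < A / x + p + 2 * q * x) ->
  log_quad A p q a < log_quad A p q b.
Proof.
move=> a0 ab df0.
have [x xab||c cab fE] :=
  @MVT R (log_quad A p q) (fun x => A / x + p + 2 * q * x) a b ab.
- apply: is_derive_log_quad.
  by move: xab; rewrite in_itv/= => /andP[/(lt_trans a0)].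
- apply: derivable_within_continuous => x; rewrite in_itv/= => /andP[ax _].
  by have := is_derive_log_quad A p q (lt_le_trans a0 ax).
- rewrite -subr_gt0 fE mulr_gt0 ?subr_gt0//; apply: df0.
  by move: cab; rewrite in_itv.
Qed.

Lemma log_quad_gt (R : realType) (A p q a b : R) : 0 < a -> a < b ->
  (forall x, a < x < b -> A / x + p + 2 * q * x < 0) ->
  log_quad A p q b < log_quad A p q a.
Proof.
move=> a0 ab df0.
have E w : log_quad A p q w = - log_quad (- A) (- p) (- q) w.
  by rewrite /log_quad; ring.
rewrite !E ltrN2; apply: log_quad_lt => // x /df0; lra.
Qed.

(** In the variable [u = b^-1] the equation of the critical ratio becomes
    [chi u = - 2^-1], as [critical_ratioV] shows.  The trivial solution [u = 1]
    takes the increasing branch [1 <= u <= 2]; exactly one other solution lies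
    on the decreasing branch, beyond [2]. *)
Definition chi (R : realType) (u : R) : R := ln u - u / 2.

Lemma chiE (R : realType) : @chi R = log_quad 1 (- 2^-1) 0.
Proof. by apply/funext => u; rewrite /chi /log_quad; lra. Qed.

Lemma critical_ratioV (R : realType) (u : R) : 0 < u ->
  (2 * u^-1 * ln u^-1 - u^-1 + 1 = 0) <->
  (chi u = - 2^-1).
Proof.
move=> u0; rewrite lnV ?posrE// /chi.
have u1 : u * u^-1 = 1 by rewrite mulfV// gt_eqF.
split=> h; last first.
  suff -> : ln u = (u - 1) / 2 by rewrite mulrN; nra.
  lra.
have /(congr1 (fun t => t * u)) := h.
rewrite mul0r => h'.
have : 2 * (- ln u) * (u * u^-1) - u * u^-1 + u = 0 by rewrite -h'; ring.
by rewrite u1; lra.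
Qed.

Lemma chi_incr (R : realType) (u v : R) : 1 <= u -> u < v -> v <= 2 ->
  chi u < chi v.
Proof.
move=> u1 uv v2; rewrite chiE.
apply: log_quad_lt => // [|x /andP[ux xv]]; first by lra.
have x0 : 0 < x by lra.
rewrite mulr0 mul0r addr0 mul1r subr_gt0 ltf_pV2 ?posrE//; lra.
Qed.

Lemma chi_decr (R : realType) (u v : R) : 2 <= u -> u < v ->
  chi v < chi u.
Proof.
move=> u2 uv; rewrite chiE.
apply: log_quad_gt => // [|x /andP[ux xv]]; first by lra.
have x0 : 0 < x by lra.
rewrite mulr0 mul0r addr0 mul1r subr_lt0 ltf_pV2 ?posrE//; lra.
Qed.

Lemma chi1 (R : realType) : chi 1 = - 2^-1 :> R.
Proof. by rewrite /chi ln1; lra. Qed.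

Lemma critical_ratio_lt_half (R : realType) (b : R) :
  critical_ratio b -> b < 2^-1.
Proof.
move=> [/andP[b0 b1] h]; rewrite ltNge; apply/negP => hb.
have := @chi_incr R 1 b^-1 (lexx _).
rewrite invf_gt1// => /(_ b1); rewrite chi1.
have := @critical_ratioV R b^-1.
rewrite invr_gt0 invrK => /(_ b0) [/(_ h) -> _].
by rewrite ltxx invf_ple ?posrE// => /(_ hb).
Qed.

Lemma critical_ratio_exists_unique (R : realType) :
  exists! b : R, critical_ratio b.
Proof.
(* At 16 the linear term of [chi] dominates: [ln 16 = 4 * ln 2 <= 4]. *)
have [|||u] := @IVT R (@chi R) 2 16 (- 2^-1).
- lra.
- rewrite chiE; apply: derivable_within_continuous => x.
  rewrite in_itv/= => /andP[ax _].
  by have := @is_derive_log_quad R 1 (- 2^-1) 0 x ltac:(lra).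
- have h2 : - 2^-1 < chi 2 :> R.
    by have := @chi_incr R 1 2 ltac:(lra) ltac:(lra) ltac:(lra); rewrite chi1.
  have h16 : chi 16 < - 2^-1 :> R.
    rewrite /chi (_ : 16 = 2 ^+ 4 :> R); last by rewrite -natrX.
    have := @le_ln1Dx R 1 ltac:(lra).
    rewrite lnXn// -[ln 2 *+ 4]mulr_natr (_ : 1 + 1 = 2 :> R); lra.
  by rewrite ge_min le_max (ltW h16) (ltW h2) orbT.
rewrite in_itv/= => /andP[u2 u16] hu.
have u0 : 0 < u by lra.
exists u^-1; split.
  split; last exact/critical_ratioV.
  by rewrite invr_gt0 u0 invf_lt1//; lra.
move=> b rb; have b2 := critical_ratio_lt_half rb; case: rb => /andP[b0 b1] hb.
apply: (canLR invrK).
have v0 : 0 < b^-1 by rewrite invr_gt0.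
have v2 : 2 < b^-1 by rewrite -[2]invrK ltf_pV2 ?posrE//; lra.
have hv : chi b^-1 = - 2^-1.
  by apply/critical_ratioV; rewrite ?invrK.
have [uv|vu|//] := ltgtP u b^-1.
- by have := chi_decr u2 uv; rewrite hu hv ltxx.
- by have := chi_decr (ltW v2) vu; rewrite hu hv ltxx.
Qed.

(** The derivative of [- C * ln r - (1 - r) ^+ 2], with [C] as below, is
    [- 2 * (r - b) * (r - (1 - b)) / r].  So on [0 < r <= 1] this function
    decreases down to [b], increases up to [1 - b], which exceeds [b], and then
    decreases; it vanishes at [b], by the equation of [b], and at [1]. *)
Lemma sqr_le_ln (R : realType) (b r : R) :
  critical_ratio b -> 0 < r -> r <= 1 ->
  (1 - r) ^+ 2 <= - (2 * b * (1 - b)) * ln r.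
Proof.
move=> rb r0 r1; have b2 := critical_ratio_lt_half rb.
case: rb => /andP[b0 b1] hb.
pose C := 2 * b * (1 - b).
have F1 : log_quad (- C) 2 (-1) 1 = 1 by rewrite /log_quad ln1; lra.
have Fb : log_quad (- C) 2 (-1) b = 1.
  rewrite /log_quad /C; have -> : - (2 * b * (1 - b)) * ln b =
    - (1 - b) * (2 * b * ln b) by ring.
  have -> : 2 * b * ln b = b - 1 by lra.
  ring.
have dE x : 0 < x ->
    - C / x + 2 + 2 * (-1) * x = - 2 * (x - b) * (x - (1 - b)) / x.
  by move=> x0; rewrite /C; field; rewrite gt_eqF.
suff : 1 <= log_quad (- C) 2 (-1) r by rewrite /log_quad /C; lra.
have [rb|br|->] := ltgtP r b; last by rewrite Fb.
  rewrite -[leLHS]Fb ltW//; apply: log_quad_gt => // x /andP[rx xb].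
  rewrite dE; last by lra.
  rewrite pmulr_llt0 ?invr_gt0; nra.
have [rb'|br'] := lerP r (1 - b).
  rewrite -[leLHS]Fb ltW//; apply: log_quad_lt => // x /andP[bx xr].
  rewrite dE; last by lra.
  rewrite pmulr_lgt0 ?invr_gt0; nra.
have [r1'|->] : r < 1 \/ r = 1; last by rewrite F1.
  by move: r1; rewrite le_eqVlt => /predU1P[]; [right|left].
rewrite -[leLHS]F1 ltW//; apply: log_quad_gt => // x /andP[rx x1].
rewrite dE; last by lra.
rewrite pmulr_llt0 ?invr_gt0; nra.
Qed.

(** * The numerical bound *)

Lemma expR_ge_sum (R : realType) (n : nat) (x : R) : 0 <= x ->
  \sum_(0 <= i < n) x ^+ i / i`!%:R <= expR x.
Proof.
move=> x0; rewrite /expR.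
have := @nondecreasing_cvgn_le R (series (exp_coeff x)).
rewrite /series/= => -> //.
  apply/nondecreasing_seqP => m.
  by rewrite big_nat_recr//= lerDl divr_ge0 ?exprn_ge0.
exact: is_cvg_series_exp_coeff.
Qed.

(** The bound on the critical value leaves a slack of only about [10 ^- 5] in
    [ln (7 / 2)], and [5 / 4 + 361^-1] lies within it.  Splitting [5 / 4] off
    the exponent and halving it lets the eight-term Taylor sum of
    [expR (5 / 8)] suffice. *)
Lemma ln_7half (R : realType) : ln (7 / 2) <= 5 / 4 + 361^-1 :> R.
Proof.
rewrite -ler_expR lnK ?posrE; last by lra.
rewrite expRD.
have h2 := @expR_ge1Dx R 361^-1.
have h3 : 7 / 2 * 361 / 362 <= expR (5 / 4) :> R.
  have -> : 5 / 4 = 5 / 8 + 5 / 8 :> R by lra.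
  rewrite expRD.
  have := @expR_ge_sum R 8 (5 / 8) ltac:(lra).
  rewrite unlock /= !factS fact0 /= => h.
  (* A simple fraction between the bound required and the Taylor sum. *)
  have c0 : 0 <= 553 / 296 :> R by lra.
  have h4 : 553 / 296 <= expR (5 / 8) :> R by apply: le_trans h; lra.
  apply: (@le_trans _ _ (553 / 296 * (553 / 296))); first by lra.
  exact: (ler_pM c0 c0 h4 h4).
have a0 : 0 <= 7 / 2 * 361 / 362 :> R by lra.
have b0 : 0 <= 1 + 361^-1 :> R by lra.
by have := ler_pM a0 b0 h3 h2; lra.
Qed.

Lemma critical_value_ge (R : realType) (b : R) : critical_ratio b ->
  40726%:R / 100000%:R <= 2 * b * (1 - b).
Proof.
move=> rb; have := sqr_le_ln (r := 2 / 7) rb ltac:(lra) ltac:(lra).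
have -> : 2 / 7 = (7 / 2)^-1 :> R by field.
rewrite lnV ?posrE; last by lra.
have := ln_7half R.
have C0 : 0 <= 2 * b * (1 - b).
  by case: rb => /andP[b0 b1] _; rewrite !mulr_ge0//; lra.
have -> : (7 / 2)^-1 = 2 / 7 :> R by field.
move: (ln (7 / 2)) (2 * b * (1 - b)) C0 => L C C0 hL h.
have : C * L <= C * (5 / 4 + 361^-1) by rewrite ler_wpM2l.
lra.
Qed.

(** * The growth of gamma *)

Lemma gamma_ge0 (R : realType) (d : nat) : (1 < d)%N -> 0 <= gamma R d.
Proof.
move=> d1; have [[k [j [_ ->]]] _] := gammaP R d1.
by apply: sumr_ge0 => l _; exact: sqr_ge0.
Qed.

Lemma gamma_le_ln (R : realType) (b : R) (d : nat) :
  critical_ratio b -> (1 < d)%N ->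
  gamma R d <= 2 * b * (1 - b) * ln d%:R.
Proof.
move=> rb d1; have [[k [j [jc ->]]] _] := gammaP R d1.
have [_ j0 jk jS] := jc.
have jpos m : (m <= k)%N -> (0 < j m)%N.
  move=> mk; have := is_chain_le (l := 0%N) jc mk.
  by rewrite j0; apply: leq_trans.
suff H m : (m <= k)%N ->
    \sum_(1 <= l < m.+1) (1 - (j l.-1)%:R / (j l)%:R) ^+ 2
      <= 2 * b * (1 - b) * ln (j m)%:R.
  by rewrite -jk; exact: H.
elim: m => [_|m IH mk].
  by rewrite big_geq// j0 ln1 mulr0.
have p1 : 0 < (j m)%:R :> R by rewrite ltr0n jpos// ltnW.
have p2 : 0 < (j m.+1)%:R :> R by rewrite ltr0n jpos.
rewrite big_nat_recr//=; have := IH (ltnW mk).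
have := sqr_le_ln (r := (j m)%:R / (j m.+1)%:R) rb (divr_gt0 p1 p2).
rewrite ler_pdivrMr// mul1r ler_nat => /(_ (ltnW (jS _ mk))).
by rewrite ln_div ?posrE//; lra.
Qed.

(** Rounding down the numerator only helps.  If [J] is the integer part of the
    denominator, rounding that down costs at most [b / J], and
    [J >= 2 ^+ m.+1]. *)
Lemma truncn_ratio_le (R : realType) (b : R) (m : nat) : 0 < b -> b <= 2^-1 ->
  (Num.truncn (b^-1 ^+ m))%:R / (Num.truncn (b^-1 ^+ m.+1))%:R
    <= b + 2^-1 ^+ m.+1 :> R.
Proof.
move=> b0 b2; set c := b^-1.
have c0 : 0 < c by rewrite invr_gt0.
have c2 : 2 <= c by rewrite -[2]invrK lef_pV2 ?posrE// invr_gt0.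
have cm n : 0 <= c ^+ n by rewrite exprn_ge0// ltW.
have /andP[_ J1] := truncn_itv (cm m.+1).
have J2 : 2 ^+ m.+1 <= (Num.truncn (c ^+ m.+1))%:R :> R.
  rewrite -natrX ler_nat truncn_ge_nat// natrX.
  by apply: lerXn2r => //; rewrite nnegrE; lra.
have J0 : 0 < (Num.truncn (c ^+ m.+1))%:R :> R.
  by apply: lt_le_trans J2; rewrite exprn_gt0.
have Jm : (Num.truncn (c ^+ m))%:R <= b * c ^+ m.+1.
  by rewrite exprS mulrA divff ?gt_eqF// mul1r truncn_le.
rewrite ler_pdivrMr//; apply: (le_trans Jm).
move: J1; rewrite -natr1; set J := _%:R; set L := c ^+ m.+1 => JL.
have : b * L <= b * (J + 1) by rewrite ler_pM2l// ltW.
have : 1 <= 2^-1 ^+ m.+1 * J.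
  by rewrite exprVn ler_pdivlMl ?exprn_gt0// mulr1.
lra.
Qed.

Lemma truncn_expr_lt (R : realType) (c : R) (l m : nat) : 2 <= c -> (l < m)%N ->
  (Num.truncn (c ^+ l) < Num.truncn (c ^+ m))%N.
Proof.
move=> c2 lm; have c0 : 0 <= c by lra.
rewrite truncn_gt_nat -natr1.
have c1 : 1 <= c ^+ l by rewrite exprn_ege1//; lra.
have : (Num.truncn (c ^+ l))%:R <= c ^+ l by rewrite truncn_le exprn_ge0.
have : c ^+ l.+1 <= c ^+ m by rewrite ler_eXn2l //; lra.
by rewrite exprS; nra.
Qed.

(** The chain consists of the integer parts of [b^-1 ^+ l] for [l <= k],
    followed by [d].  The [l]-th ratio exceeds [b] by at most [2^-1 ^+ l], so
    each square is at least [(1 - b) ^+ 2 - 2 * 2^-1 ^+ l], and these losses sum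
    to less than [2]. *)
Lemma gamma_ge_geometric (R : realType) (b : R) (d k : nat) :
  0 < b -> b <= 2^-1 -> b^-1 ^+ k.+1 <= d%:R ->
  k%:R * (1 - b) ^+ 2 - 2 <= gamma R d.
Proof.
move=> b0 b2; set c := b^-1 => cd.
have c2 : 2 <= c by rewrite -[2]invrK lef_pV2 ?posrE// invr_gt0.
have d1 : (1 < d)%N.
  rewrite -(ltr_nat R); apply: lt_le_trans cd.
  by rewrite exprn_egt1//; lra.
pose j l := if (l <= k)%N then Num.truncn (c ^+ l) else d.
have jc : is_chain d k.+1 j.
  split => //.
  - by rewrite /j/= expr0 truncn1.
  - by rewrite /j ltnn.
  - move=> l; rewrite ltnS => lk; rewrite /j lk; case: ifP => lk'.
      exact: truncn_expr_lt.
    apply: (@leq_trans (Num.truncn (c ^+ k.+1))).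
      by apply: truncn_expr_lt => //; rewrite ltnS.
    by rewrite -(ler_nat R) (le_trans _ cd)// truncn_le exprn_ge0//; lra.
have [_ ub] := gammaP R d1.
apply: le_trans (ub _ (ex_intro _ k.+1 (ex_intro _ j (conj jc erefl)))).
rewrite /chain_sum big_nat_recr//=.
have H m : (m <= k)%N -> m%:R * (1 - b) ^+ 2 - 2 + 2 * 2^-1 ^+ m <=
    \sum_(1 <= l < m.+1) (1 - (j l.-1)%:R / (j l)%:R) ^+ 2 :> R.
  elim: m => [_|m IH mk]; first by rewrite big_geq// expr0; lra.
  rewrite big_nat_recr//=; have := IH (ltnW mk).
  have := truncn_ratio_le m b0 b2.
  have -> : j m = Num.truncn (c ^+ m) by rewrite /j (ltnW mk).
  have -> : j m.+1 = Num.truncn (c ^+ m.+1) by rewrite /j mk.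
  rewrite -/c -natr1 [2^-1 ^+ m.+1]exprS.
  set r := _ / _; set S := \sum_(_ <= _ < _) _.
  have : 0 <= 2^-1 ^+ m :> R by rewrite exprn_ge0.
  set e := 2^-1 ^+ m => e0 hr hS.
  have : (1 - b) ^+ 2 - e <= (1 - r) ^+ 2.
    have : 0 <= (1 - b) * (b + 2^-1 * e - r) by rewrite mulr_ge0; lra.
    have : 0 <= b * e by rewrite mulr_ge0// ltW.
    have := sqr_ge0 (b - r); lra.
  lra.
have := H k (leqnn _).
have : 0 <= 2^-1 ^+ k :> R by rewrite exprn_ge0.
have := sqr_ge0 (1 - (j k)%:R / (j k.+1)%:R : R).
lra.
Qed.

(** Take for [k] the integer part of [ln d / ln b^-1] in
    [gamma_ge_geometric]; the equation of [b] gives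
    [(1 - b) ^+ 2 / ln b^-1 = 2 * b * (1 - b)]. *)
Lemma ln_le_gamma (R : realType) (b : R) (d : nat) :
  critical_ratio b -> (1 < d)%N ->
  2 * b * (1 - b) * ln d%:R - 4 <= gamma R d.
Proof.
move=> rb d1; have b2 := critical_ratio_lt_half rb.
case: rb => /andP[b0 b1] hb.
have L0 : 0 < ln b^-1 by rewrite ln_gt0// invf_gt1.
have CL : 2 * b * (1 - b) * ln b^-1 = (1 - b) ^+ 2.
  rewrite lnV ?posrE//.
  transitivity (- (1 - b) * (2 * b * ln b)); first by ring.
  have -> : 2 * b * ln b = b - 1 by lra.
  ring.
have ld0 : 0 <= ln (d%:R : R) by rewrite ln_ge0// ler1n ltnW.
have q0 : 0 <= ln (d%:R : R) / ln b^-1 by rewrite divr_ge0// ltW.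
have /andP[k1 k2] := truncn_itv q0.
have Cd : 2 * b * (1 - b) * ln d%:R = (1 - b) ^+ 2 * (ln d%:R / ln b^-1).
  by rewrite -CL; field; rewrite gt_eqF.
have s1 : (1 - b) ^+ 2 <= 1 by nra.
have s0 : 0 <= (1 - b) ^+ 2 by exact: sqr_ge0.
rewrite Cd; move: k1 k2; case: (Num.truncn _) => [|k] k1 k2.
  by have := gamma_ge0 R d1; nra.
have /(gamma_ge_geometric b0 (ltW b2)) : b^-1 ^+ k.+1 <= d%:R.
  rewrite -ler_ln ?posrE ?exprn_gt0 ?invr_gt0 ?ltr0n ?(ltnW d1)//.
  rewrite lnXn ?invr_gt0// -[_ *+ k.+1]mulr_natl.
  by move: k1; rewrite ler_pdivlMr.
move: k1 k2; rewrite -!natr1; set q := _ / _; nra.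
Qed.

Lemma gamma_div_ln_cvg (R : realType) (b : R) : critical_ratio b ->
  (fun d : nat => gamma R d / ln (d%:R : R)) @ \oo --> 2 * b * (1 - b).
Proof.
move=> rb; apply/cvgrPdist_le => e e0.
near=> d.
have d1 : (1 < d)%N by near: d; exact: nbhs_infty_gt.
have dl : 4 / e <= ln (d%:R : R).
  rewrite -ler_expR lnK ?posrE ?ltr0n ?(ltnW d1)//.
  near: d; exact: nbhs_infty_ger.
have l0 : 0 < ln (d%:R : R) by apply: lt_le_trans dl; rewrite divr_gt0.
have := ln_le_gamma rb d1; have := gamma_le_ln rb d1.
move: dl; rewrite ler_pdivrMr// => dl h1 h2.
rewrite ger0_norm; last by rewrite subr_ge0 ler_pdivrMr.
rewrite lerBlDr -lerBlDl ler_pdivlMr//; lra.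
Unshelve. all: by end_near.
Qed.

Theorem theorem1p1 (R : realType) :
  (forall d : nat, (2 <= d)%N -> ((gamma R d)%:E <= delta_star R d)%E) /\
  (exists! beta : R, 0 < beta < 1 /\ 2 * beta * ln beta - beta + 1 = 0) /\
  (forall beta : R, 0 < beta < 1 -> 2 * beta * ln beta - beta + 1 = 0 ->
     ((fun d : nat => gamma R d / ln (d%:R : R)) @ \oo -->
        2 * beta * (1 - beta)) /\
     40726%:R / 100000%:R <= 2 * beta * (1 - beta)).
Proof.
split; first by move=> d; exact: gamma_le_delta_star.
split; first exact: critical_ratio_exists_unique.
move=> beta b01 hb; have rb : critical_ratio beta by split.
by split; [exact: gamma_div_ln_cvg|exact: critical_value_ge].
Qed.
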